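(* Let $(u^n)_{0\le n\le N_t}\subset\mathcal V_h$, together with intermediate grid functions $u^{n,1},u^{n,2},u^{n,3}\in\mathcal V_h$, satisfy for every $0\le n\le N_t-1$ and every $i$ the Strang-HOC difference scheme $$\mathcal H_{1x}u_i^{n,1}=\mathcal H_{2x}u_i^{n},$$ $$\mathcal B_x u_i^{n,2}=\mathcal B_x u_i^{n,1}-\tau D_{\hat x}f(u^{n,1})_i+\tau\mathcal B_x S_i^n,$$ $$\mathcal B_x u_i^{n,3}=\mathcal B_x u_i^{n,1}-\tfrac{\tau}{2}D_{\hat x}\big(f(u^{n,1})+f(u^{n,2})\big)_i+\tfrac{\tau}{2}\mathcal B_x\big(S_i^n+S_i^{n+1}\big),$$ $$\mathcal H_{1x}u_i^{n+1}=\mathcal H_{2x}u_i^{n,3}.$$ Then for every $n=0,\dots,N_t-1$, $$(u^{n+1},1)=(u^{0},1)+\frac{\tau}{2}\sum_{k=0}^{n}\big(S^k+S^{k+1},1\big).$$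
   Context: The scheme discretizes $u_t+f(u)_x-\nu u_{xx}=S(x,t)$ on $[0,L]\times[0,T]$ with periodic boundary condition and $\nu>0$; $f$ and $S$ are smooth functions, with $S$ being $L$-periodic in $x$. Let $N_t$ and $N_x\ge 3$ be positive integers, $\tau=T/N_t$, $t^n=n\tau$, $h_x=L/N_x$, $x_i=ih_x$. $\mathcal V_h$ is the space of periodic grid functions $v=\{v_i\}$ with $v_{i+N_x}=v_i$. For $v\in\mathcal V_h$: $$D_{\hat x}v_i=\frac{v_{i+1}-v_{i-1}}{2h_x},\quad \delta_x^2v_i=\frac{v_{i+1}-2v_i+v_{i-1}}{h_x^2},\quad \mathcal A_xv_i=\tfrac1{12}(v_{i-1}+10v_i+v_{i+1}),\quad \mathcal B_xv_i=\tfrac16(v_{i-1}+4v_i+v_{i+1}),$$ $$\mathcal H_{1x}=\mathcal A_x-\tfrac{\tau}{4}\nu\delta_x^2,\qquad \mathcal H_{2x}=\mathcal A_x+\tfrac{\tau}{4}\nu\delta_x^2.$$ Here $f(v)$ denotes the grid function $\{f(v_i)\}$ and $S^n=\{S_i^n\}$ with $S_i^n=S(x_i,t^n)$. The discrete inner product is $(w,v)=\sum_{i=1}^{N_x}h_xw_iv_i$, and $1$ denotes the constant grid function. $u^0$ is the grid function of initial values. *)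

(* Defs.v *)
From mathcomp Require Import all_boot all_order all_algebra.
From mathcomp Require Import all_classical all_reals all_analysis.
Import Order.TTheory GRing.Theory Num.Theory.
Import numFieldNormedType.Exports.

Set Implicit Arguments.
Unset Strict Implicit.
Unset Printing Implicit Defensive.

Local Open Scope classical_set_scope.
Local Open Scope ring_scope.

(* All directional derivatives of order at most k exist and are continuous
   on U.  For U open in a finite-dimensional V this is the usual class C^k. *)
Fixpoint Ck (R : realType) (V : normedModType R) (k : nat) (U : set V)
    (g : V -> R) : Prop :=
  (forall x, U x -> {for x, continuous g}) /\
  (if k is k'.+1 then
     forall v : V, (forall x, U x -> derivable g x v) /\ Ck k' U ('D_v g)
   else True).

(* C^oo on a possibly non-open set A: restriction to A of a C^oo function
   defined on an open neighbourhood of A. *)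
Definition smooth_on (R : realType) (V : normedModType R) (A : set V)
    (g : V -> R) : Prop :=
  exists (U : set V) (h : V -> R),
    [/\ open U, A `<=` U, (forall k, Ck k U h) & forall x, A x -> h x = g x].

(* The space V_h consists of the grid functions satisfying periodic_grid. *)
Definition grid_fun (R : realType) : Type := int -> R.

Definition periodic_grid (R : realType) (Nx : nat) (v : grid_fun R) : Prop :=
  forall i : int, v (i + Nx%:Z) = v i.

Section Operators.
Variables (R : realType) (hx tau nu : R).
Implicit Type v : grid_fun R.

Definition Dhat v : grid_fun R :=
  fun i => (v (i + 1) - v (i - 1)) / (2 * hx).

Definition delta2 v : grid_fun R :=
  fun i => (v (i + 1) - 2 * v i + v (i - 1)) / hx ^+ 2.

Definition Aop v : grid_fun R :=
  fun i => 12^-1 * (v (i - 1) + 10 * v i + v (i + 1)).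

Definition Bop v : grid_fun R :=
  fun i => 6^-1 * (v (i - 1) + 4 * v i + v (i + 1)).

Definition H1 v : grid_fun R :=
  fun i => Aop v i - tau / 4 * nu * delta2 v i.

Definition H2 v : grid_fun R :=
  fun i => Aop v i + tau / 4 * nu * delta2 v i.

Definition grid_ip (Nx : nat) (w v : grid_fun R) : R :=
  \sum_(1 <= i < Nx.+1) hx * w i%:Z * v i%:Z.

Definition grid_one : grid_fun R := fun=> 1.

Definition grid_add (w v : grid_fun R) : grid_fun R := fun i => w i + v i.

Definition grid_comp (f : R -> R) v : grid_fun R := fun i => f (v i).

Definition sample (S : R * R -> R) (n : nat) : grid_fun R :=
  fun i => S (i%:~R * hx, n%:R * tau).

End Operators.

(* Main.v *)
(* Summed over one period, a stencil acts as multiplication by the sum of its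
   weights: 1 for A_x, B_x, H_1x, H_2x and 0 for the central difference.  So
   the diffusion half-steps preserve the mass, the flux terms vanish, and each
   time step adds exactly the quadrature of the source. *)
Require Import Defs.
From mathcomp Require Import all_boot all_order all_algebra.
From mathcomp Require Import all_classical all_reals all_analysis.
From mathcomp Require Import ring.
Import Order.TTheory GRing.Theory Num.Theory.
Import numFieldNormedType.Exports.

Set Implicit Arguments.
Unset Strict Implicit.

Local Open Scope classical_set_scope.
Local Open Scope ring_scope.

(** The weight [hx] is left out so that no mesh width enters the stencil sums; [grid_ip_one]
    restores it. *)
Definition mass (R : realType) (N : nat) (v : grid_fun R) : R :=
  \sum_(1 <= i < N.+1) v i%:Z.

(** The difference of the two sums telescopes to [v (N + 1) - v 1], which vanishes by
    periodicity. *)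
Lemma mass_shift (R : realType) (N : nat) (v : grid_fun R) :
  periodic_grid N v -> mass N (fun i => v (i + 1)) = mass N v.
Proof.
move=> pv; apply/eqP; rewrite -subr_eq0 /mass -sumrB; apply/eqP.
rewrite (eq_bigr (fun i : nat => v i.+1%:Z - v i%:Z)); last first.
  by move=> i _; rewrite -addn1 PoszD.
rewrite (telescope_sumr (fun i : nat => v i%:Z)) //.
by rewrite -add1n PoszD pv subrr.
Qed.

Lemma mass_stencil (R : realType) (N : nat) (a b c : R) (v w : grid_fun R) :
  periodic_grid N v ->
  (forall i, w i = a * v (i - 1) + b * v i + c * v (i + 1)) ->
  mass N w = (a + b + c) * mass N v.
Proof.
move=> pv ew.
have pv' : periodic_grid N (fun i => v (i - 1)) by move=> i /=; rewrite addrAC pv.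
have back : mass N (fun i => v (i - 1)) = mass N v.
  rewrite -(mass_shift pv'); apply: eq_bigr => i _.
  by rewrite addrK.
(* Each copy of [mass N v] becomes the mass of the translate that its weight multiplies, so the
   claim holds term by term. *)
rewrite !mulrDl -{1}back -{2}(mass_shift pv) /mass.
rewrite !mulr_sumr -!big_split; apply: eq_bigr => i _ /=.
exact: ew.
Qed.

Lemma mass_Dhat (R : realType) (N : nat) (hx : R) (v : grid_fun R) :
  periodic_grid N v -> mass N (Dhat hx v) = 0.
Proof.
move=> pv.
rewrite (mass_stencil (a := - (2 * hx)^-1) (b := 0) (c := (2 * hx)^-1) pv).
  by rewrite addr0 addNr mul0r.
by move=> i; rewrite /Dhat; set d := (2 * hx)^-1; ring.
Qed.

Lemma mass_Bop (R : realType) (N : nat) (v : grid_fun R) :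
  periodic_grid N v -> mass N (Bop v) = mass N v.
Proof.
move=> pv; rewrite (mass_stencil (a := 6^-1) (b := 4 / 6) (c := 6^-1) pv).
  by field.
by move=> i; rewrite /Bop; field.
Qed.

Lemma mass_H1 (R : realType) (N : nat) (hx tau nu : R) (v : grid_fun R) :
  periodic_grid N v -> mass N (H1 hx tau nu v) = mass N v.
Proof.
(* The second difference contributes [d] times the weights -1, 2, -1, which cancel in the sum and
   leave the total weight of [Aop]. *)
move=> pv; pose d := tau / 4 * nu * (hx ^+ 2)^-1.
rewrite (mass_stencil (a := 12^-1 - d) (b := 10 / 12 + 2 * d)
                      (c := 12^-1 - d) pv); first by field.
by move=> i; rewrite /H1 /Aop /delta2 /d; set e := (hx ^+ 2)^-1; field.
Qed.

(* Changing the sign of tau turns H_1x into H_2x. *)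
Lemma mass_H2 (R : realType) (N : nat) (hx tau nu : R) (v : grid_fun R) :
  periodic_grid N v -> mass N (H2 hx tau nu v) = mass N v.
Proof.
move=> pv; rewrite -(mass_H1 hx (- tau) nu pv); apply: eq_bigr => i _.
by rewrite /H1 /H2 !mulNr opprK.
Qed.

Lemma periodic_grid_comp (R : realType) (N : nat) (f : R -> R)
    (v : grid_fun R) : periodic_grid N v -> periodic_grid N (grid_comp f v).
Proof. by move=> pv i; rewrite /grid_comp pv. Qed.

Lemma periodic_grid_add (R : realType) (N : nat) (v w : grid_fun R) :
  periodic_grid N v -> periodic_grid N w -> periodic_grid N (grid_add v w).
Proof. by move=> pv pw i; rewrite /grid_add pv pw. Qed.

(** [N] cells of width [L / N] span exactly one period. The time level is fixed because [S] is only
    known to be periodic for times in [0, T]. *)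
Lemma periodic_sample (R : realType) (L tau : R) (N n : nat) (S : R * R -> R) :
  (0 < N)%N -> (forall x, S (x + L, n%:R * tau) = S (x, n%:R * tau)) ->
  periodic_grid N (sample (L / N%:R) tau S n).
Proof.
move=> N0 pS i; rewrite /sample intrD mulrDl -pmulrn.
by rewrite (mulrC N%:R) divfK ?pnatr_eq0 -?lt0n.
Qed.

Lemma grid_ip_one (R : realType) (hx : R) (N : nat) (v : grid_fun R) :
  grid_ip hx N v (@grid_one R) = hx * mass N v.
Proof. by rewrite mulr_sumr; apply: eq_bigr => i _; rewrite mulr1. Qed.

Theorem theorem1 (R : realType) (L T nu : R) (f : R -> R) (S : R * R -> R)
    (Nt Nx : nat) (u u1 u2 u3 : nat -> grid_fun R) :
  0 < L -> 0 < T -> 0 < nu ->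
  smooth_on [set: R] f ->
  smooth_on ([set: R] `*` [set t : R | 0 <= t <= T]) S ->
  (forall x t : R, 0 <= t <= T -> S (x + L, t) = S (x, t)) ->
  (0 < Nt)%N -> (3 <= Nx)%N ->
  let tau := T / Nt%:R in
  let hx := L / Nx%:R in
  let Sg := sample hx tau S in
  (forall n : nat, (n <= Nt)%N -> periodic_grid Nx (u n)) ->
  (forall n : nat, (n < Nt)%N ->
     [/\ periodic_grid Nx (u1 n), periodic_grid Nx (u2 n)
       & periodic_grid Nx (u3 n)]) ->
  (forall (n : nat) (i : int), (n < Nt)%N ->
     [/\ H1 hx tau nu (u1 n) i = H2 hx tau nu (u n) i,
         Bop (u2 n) i = Bop (u1 n) i - tau * Dhat hx (grid_comp f (u1 n)) i
                        + tau * Bop (Sg n) i,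
         Bop (u3 n) i = Bop (u1 n) i
           - tau / 2 * Dhat hx (grid_add (grid_comp f (u1 n))
                                         (grid_comp f (u2 n))) i
           + tau / 2 * Bop (grid_add (Sg n) (Sg n.+1)) i
       & H1 hx tau nu (u n.+1) i = H2 hx tau nu (u3 n) i]) ->
  forall n : nat, (n < Nt)%N ->
    grid_ip hx Nx (u n.+1) (@grid_one R) =
    grid_ip hx Nx (u 0%N) (@grid_one R)
    + tau / 2 * \sum_(0 <= k < n.+1)
                  grid_ip hx Nx (grid_add (Sg k) (Sg k.+1)) (@grid_one R).
Proof.
move=> L0 T0 _ _ _ pS Nt0 Nx3 tau hx Sg pu pu123 scheme.
(* The bound includes [Nt]: the last step samples the source at the final time [T]. *)
have pSg n : (n <= Nt)%N -> periodic_grid Nx (Sg n).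
  move=> nNt; apply: periodic_sample => [|x]; first exact: leq_trans Nx3.
  apply: pS; rewrite mulr_ge0 ?divr_ge0 ?ler0n ?(ltW T0) //=.
  rewrite /tau mulrCA ler_piMr ?(ltW T0) //.
  by rewrite ler_pdivrMr ?ltr0n // mul1r ler_nat.
have step n : (n < Nt)%N -> mass Nx (u n.+1) =
    mass Nx (u n) + tau / 2 * mass Nx (grid_add (Sg n) (Sg n.+1)).
  move=> nNt; have [p1 p2 p3] := pu123 n nNt.
  have pF : periodic_grid Nx (grid_add (grid_comp f (u1 n)) (grid_comp f (u2 n))).
    by apply: periodic_grid_add; apply: periodic_grid_comp.
  have pSS : periodic_grid Nx (grid_add (Sg n) (Sg n.+1)).
    by apply: periodic_grid_add; apply: pSg => //; apply: ltnW.
  (* Summing the implicit equation over a period suffices, since both of its operators preserve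
     mass; [H1] is never inverted. *)
  have e1 : mass Nx (u1 n) = mass Nx (u n).
    rewrite -(mass_H1 hx tau nu p1) -(mass_H2 hx tau nu (pu n (ltnW nNt))).
    by apply: eq_bigr => i _; have [] := scheme n i nNt.
  have e3 : mass Nx (u n.+1) = mass Nx (u3 n).
    rewrite -(mass_H1 hx tau nu (pu n.+1 nNt)) -(mass_H2 hx tau nu p3).
    by apply: eq_bigr => i _; have [] := scheme n i nNt.
  rewrite e3 -e1 -(mass_Bop p3) -(mass_Bop p1) -(mass_Bop pSS).
  (* Zero is reinserted as [tau / 2] times the mass of the flux difference, which makes the goal the
     sum over one period of the equation for [u3]. *)
  rewrite -[mass Nx (Bop (u1 n))]subr0 -(mulr0 (tau / 2)) -(mass_Dhat hx pF).
  rewrite /mass !mulr_sumr -sumrB -big_split; apply: eq_bigr => i _ /=.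
  by have [] := scheme n i nNt.
(* The base case is already one full time step, with the single source term [k = 0]. *)
elim=> [|n IHn] nNt; rewrite big_nat_recr //=.
  by rewrite big_nil add0r !grid_ip_one step // mulrDr mulrCA.
rewrite mulrDr addrA -IHn ?(ltnW nNt) // !grid_ip_one step //.
by rewrite mulrDr mulrCA.
Qed.
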